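(* Let $\alpha\ge-1/2$ and $j,\ell\in\mathbb{N}$. There exists a constant $c>0$ such that $$\frac{d^j}{du^j}\frac{\varphi_k^\alpha(u)}{u^{\alpha+1/2-\ell}}\simeq\begin{cases}(k+1)^{\alpha/2}u^{\ell-j},&\text{if }\ell\ge j,\\[4pt](-1)^{\lceil\frac{j-\ell}{2}\rceil}(k+1)^{\alpha/2+\lceil\frac{j-\ell}{2}\rceil}u^{\frac{1-(-1)^{j-\ell}}{2}},&\text{if }\ell\le j,\end{cases}$$ uniformly in $k\in\mathbb{N}$ and $u\in(0,c(k+1)^{-1/2})$.
   Context: $\mathbb{N}=\{0,1,2,\ldots\}$; $\lceil\cdot\rceil$ is the ceiling. The Laguerre functions of Hermite type are $\varphi_k^\alpha(u)=\big(\frac{2\Gamma(k+1)}{\Gamma(k+\alpha+1)}\big)^{1/2}L_k^\alpha(u^2)e^{-u^2/2}u^{\alpha+1/2}$, $u>0$, where $L_k^\alpha$ is the Laguerre polynomial of degree $k$ and order $\alpha$. For positive $B$, $A\simeq B$ uniformly means that there are constants $0<m\le M$, independent of $k$ and $u$ (they may depend on $\alpha,j,\ell$), with $mB\le A\le MB$; $A\simeq-B$ means that $A$ is negative and $-A\simeq B$. (Thus $A\simeq(-1)^iB$ also asserts that $A$ has sign $(-1)^i$.) *)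

(* Defs.v *)
From mathcomp Require Import all_boot all_order all_algebra.
From mathcomp Require Import all_classical all_reals all_analysis.
Import Order.TTheory GRing.Theory Num.Theory.
Import numFieldNormedType.Exports.

Set Implicit Arguments.
Unset Strict Implicit.
Unset Printing Implicit Defensive.

Local Open Scope classical_set_scope.
Local Open Scope ring_scope.

(* The integral converges for 0 < x, the only range in which Gamma is used. *)
Definition Gamma (R : realType) (x : R) : R :=
  Rintegral (@lebesgue_measure R) `]0, +oo[
    (fun t : R => t `^ (x - 1) * expR (- t)).

Definition gbinom (R : realType) (x : R) (n : nat) : R :=
  (\prod_(i < n) (x - i%:R)) / n`!%:R.

(* L_k^a(x) = sum_(i <= k) (-1)^i binom(k + a, k - i) x^i / i! *)
Definition laguerre (R : realType) (a : R) (k : nat) : {poly R} :=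
  \poly_(i < k.+1) ((-1) ^+ i * gbinom (k%:R + a) (k - i) / i`!%:R).

Definition laguerre_hermite (R : realType) (a : R) (k : nat) (u : R) : R :=
  Num.sqrt (2 * Gamma (k%:R + 1) / Gamma (k%:R + a + 1))
  * (laguerre a k).[u ^+ 2] * expR (- (u ^+ 2 / 2)) * u `^ (a + 1 / 2).

(* Two-sided comparability, uniform in the pairs (k, u) satisfying D. The
   right-hand side B is meant to be positive on D. *)
Definition unif_simeq (R : realType) (D : nat -> R -> Prop)
    (A B : nat -> R -> R) : Prop :=
  exists m M : R, [/\ 0 < m, m <= M &
    forall (k : nat) (u : R), D k u ->
      m * B k u <= A k u /\ A k u <= M * B k u].

(* "A is comparable to (-1)^i B": for odd i, A is negative and -A is
   comparable to B. *)
Definition unif_simeq_sign (R : realType) (i : nat) (D : nat -> R -> Prop)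
    (A B : nat -> R -> R) : Prop :=
  if odd i then
    (forall (k : nat) (u : R), D k u -> A k u < 0) /\
    unif_simeq D (fun k u => - A k u) B
  else unif_simeq D A B.

(* Main.v *)
Require Import Defs.
From mathcomp Require Import all_boot all_order all_algebra.
From mathcomp Require Import all_classical all_reals all_analysis.
From mathcomp Require Import measurable_realfun ring lra zify.
Import Order.TTheory GRing.Theory Num.Theory.
Import numFieldNormedType.Exports.
Local Open Scope classical_set_scope.
Local Open Scope ring_scope.

(* For u > 0 the function to be differentiated is C_k p_0(u) e^{-u^2/2}, where
   p_0(u) = u^l L_k^a(u^2), so its j-th derivative is C_k p_j(u) e^{-u^2/2} with
   p_{j+1} = p_j' - X p_j. The coefficients of L_k^a alternate in sign, and this
   recursion preserves alternation: the coefficient of u^{l+2i-j} in p_j has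
   sign (-1)^i, and no cancellation occurs in computing it. Hence it is at most
   b_k K (rho (k+1))^i and, for a fixed i, at least m b_k (k+1)^i, where
   b_k = binom(k+a, k) is the constant coefficient of L_k^a. The lowest power
   with nonzero coefficient has i = ceil((j-l)/2), and it dominates the
   remaining, geometrically bounded, terms when (k+1) u^2 is small. Finally,
   Gamma(k+a+1) = Gamma(a+1) k! b_k and b_k is comparable to (k+1)^a, so
   C_k b_k is comparable to (k+1)^{a/2}. *)

(** * Functional equation and positivity of the Gamma function *)

Section GammaFunction.
Context {R : realType}.
Local Notation mu := (@lebesgue_measure R).

(** Raise s <= exp s, at s = t / (2p), to the power p: this gives t^p <= (2p)^p exp (t / 2). *)
Lemma powR_expRN_le (p : R) : 0 < p ->
  exists M : R, 0 < M /\
    forall t : R, 0 < t -> t `^ p * expR (- t) <= M * expR (- (t / 2)).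
Proof.
move=> p0; exists ((2 * p) `^ p); split; first by rewrite powR_gt0// mulr_gt0.
move=> t t0.
have -> : expR (- t) = expR (- (t / 2)) * expR (- (t / 2)).
  by rewrite -expRD; congr expR; field.
rewrite mulrA ler_pM2r ?expR_gt0//.
rewrite expRN ler_pdivrMr ?expR_gt0//.
have -> : expR (t / 2) = expR (t / (2 * p)) `^ p.
  by rewrite -expRM; congr expR; field; rewrite gt_eqF.
rewrite -powRM ?expR_ge0//; last by rewrite mulr_ge0// ltW.
apply: ge0_ler_powR; rewrite ?nnegrE ?mulr_ge0 ?expR_ge0 ?ltW//.
have tE : t = 2 * p * (t / (2 * p)) by field; rewrite gt_eqF.
rewrite [ltLHS]tE ltr_pM2l ?mulr_gt0// (lt_le_trans _ (expR_ge1Dx _))//.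
by rewrite ltrDr.
Qed.

Lemma is_derive_powR_expRN (p t : R) : 0 < t ->
  is_derive t 1 (fun s => s `^ p * expR (- s))
    (p * (t `^ (p - 1) * expR (- t)) - t `^ p * expR (- t)).
Proof.
move=> t0.
have h1 := is_derive1_powR p t0.
apply: is_derive_eq.
rewrite /GRing.scale/=; ring.
Qed.

Lemma continuous_powR_expRN (p t : R) : 0 < t ->
  {for t, continuous (fun s : R => s `^ p * expR (- s))}.
Proof.
move=> t0; apply/differentiable_continuous/derivable1_diffP.
by have [] := is_derive_powR_expRN p t t0.
Qed.

Lemma measurable_powR_expRN (p : R) (D : set R) :
  measurable_fun D (fun s : R => s `^ p * expR (- s)).
Proof.
apply: measurable_funTS; apply: measurable_funM.
  exact: measurable_powR.
by apply: measurableT_comp => //; exact: measurable_funN.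
Qed.

Lemma integral_ge0_FTC2y_pos (f F : R -> R) (e l : R) : 0 < e ->
  (forall t : R, e <= t -> 0 <= f t) ->
  (forall t : R, 0 < t -> {for t, continuous f}) ->
  (forall t : R, 0 < t -> is_derive t 1 F (f t)) ->
  F t @[t --> +oo] --> l ->
  (\int[mu]_(t in `[e, +oo[) (f t)%:E = (l - F e)%:E)%E.
Proof.
move=> e0 f0 cf dF Fl.
rewrite (@ge0_continuous_FTC2y _ f F e l) ?EFinB//.
- apply/continuous_within_itvcyP; split.
    move=> t; rewrite in_itv/= andbT => et; apply: cf; exact: lt_trans et.
  by apply: cvg_at_right_filter; exact: cf.
- by move=> t et; have [] := dF t (lt_trans e0 et).
- apply: cvg_at_right_filter.
  apply/differentiable_continuous/derivable1_diffP.
  by have [] := dF e e0.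
- move=> t; rewrite in_itv/= andbT => et.
  by rewrite derive1E; have [_ ->] := dF t (lt_trans e0 et).
Qed.

Lemma cvg_expRN_half (M : R) : M * expR (- (t / 2)) @[t --> +oo] --> (0:R).
Proof.
rewrite -(mulr0 M); apply: cvgMl_tmp.
apply: (@cvg_comp _ _ _ (fun t : R => t / 2) (fun t => expR (- t)) _ (pinfty_nbhs R)).
  by apply: gt0_cvgMly => //; rewrite invr_gt0.
exact: cvgr_expR.
Qed.

Lemma cvg_powR_expRN (p : R) : 0 < p ->
  t `^ p * expR (- t) @[t --> +oo] --> (0:R).
Proof.
move=> p0; have [M [M0 hM]] := powR_expRN_le p p0.
apply: (@squeeze_cvgr _ _ _ _ (fun=> 0) (fun t => M * expR (- (t / 2)))).
- near=> t; have t0 : 0 < t by near: t; exact: nbhs_pinfty_gt.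
  by rewrite mulr_ge0 ?powR_ge0 ?expR_ge0//= hM.
- exact: cvg_cst.
- exact: cvg_expRN_half.
Unshelve. all: by end_near. Qed.

Lemma is_derive_expRN_half (M t : R) :
  is_derive t 1 (fun s => - (2 * M) * expR (- (s / 2))) (M * expR (- (t / 2))).
Proof.
apply: is_derive_eq.
by rewrite /GRing.scale/=; field.
Qed.

Lemma continuous_expRN_half (M t : R) :
  {for t, continuous (fun s : R => M * expR (- (s / 2)))}.
Proof.
apply/differentiable_continuous/derivable1_diffP.
have [+ _] := is_derive_expRN_half (- (M / 2)) t.
by rewrite (_ : - (2 * - (M / 2)) = M)//; field.
Qed.

(* The recursion is integrated on [e, oo) with the exponential tail
   [M * expR (- t / 2)] added, which makes every integrand nonnegative. *)
Lemma integral_powR_expRN_step (x : R) : 0 < x ->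
  exists M : R, forall e : R, 0 < e ->
    (\int[mu]_(t in `[e, +oo[) (t `^ x * expR (- t))%:E <= M%:E)%E /\
    (\int[mu]_(t in `[e, +oo[) (t `^ x * expR (- t))%:E =
     x%:E * \int[mu]_(t in `[e, +oo[) (t `^ (x - 1) * expR (- t))%:E +
     (e `^ x * expR (- e))%:E)%E.
Proof.
move=> x0; have [M [M0 hM]] := powR_expRN_le x x0.
exists (2 * M) => e e0; pose D := `[e, +oo[%classic : set R.
have mD : measurable D by exact: measurable_itv.
have Dgt0 t : D t -> 0 < t.
  by rewrite /D/= in_itv/= andbT; exact: lt_le_trans.
pose h (t : R) := M * expR (- (t / 2)).
pose g (t : R) := h t - t `^ x * expR (- t).
have mh : measurable_fun D (EFin \o h).
  apply/measurable_EFinP; apply: measurable_funTS; apply: continuous_measurable_fun => t.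
  exact: continuous_expRN_half.
have mg : measurable_fun D (EFin \o g).
  apply/measurable_EFinP; apply: measurable_funB; first by apply/measurable_EFinP.
  exact: measurable_powR_expRN.
have mp (p : R) : measurable_fun D (fun t => (t `^ p * expR (- t))%:E).
  by apply/measurable_EFinP; exact: measurable_powR_expRN.
have p0 (p t : R) : 0 <= t `^ p * expR (- t) by rewrite mulr_ge0 ?powR_ge0 ?expR_ge0.
have g0 t : D t -> 0 <= g t by move=> /Dgt0 t0; rewrite subr_ge0 hM.
have hE : (\int[mu]_(t in D) (h t)%:E = (2 * h e)%:E)%E.
  rewrite (@integral_ge0_FTC2y_pos h (fun t => - (2 * M) * expR (- (t / 2))) e 0 e0 _ _
      (fun t _ => is_derive_expRN_half M t))//.
  - by rewrite /h; congr EFin; ring.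
  - by move=> t _; rewrite mulr_ge0 ?expR_ge0// ltW.
  - by move=> t _; exact: continuous_expRN_half.
  - exact: cvg_expRN_half.
have hgE : (\int[mu]_(t in D) (h t)%:E =
    \int[mu]_(t in D) (g t)%:E + \int[mu]_(t in D) (t `^ x * expR (- t))%:E)%E.
  rewrite -ge0_integralD//=; last 2 first.
  - by move=> t _; rewrite lee_fin.
  - exact: mp.
  by apply: eq_integral => t _; rewrite -EFinD /g subrK.
(* The combined integrand is the derivative of t^x exp (-t) - 2M exp (-t / 2), which tends to 0 at
   infinity. *)
have gE : (\int[mu]_(t in D) (g t)%:E +
    x%:E * \int[mu]_(t in D) (t `^ (x - 1) * expR (- t))%:E =
    (2 * h e - e `^ x * expR (- e))%:E)%E.
  rewrite -ge0_integralZl_EFin//; last 3 first.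
  - by move=> t _; rewrite lee_fin.
  - exact: mp.
  - exact: ltW.
  rewrite -ge0_integralD//=; last 2 first.
  - by move=> t _; rewrite lee_fin mulr_ge0// ltW.
  - by apply: measurable_funeM; exact: mp.
  under eq_integral do rewrite -EFinM -EFinD.
  have dF (t : R) : 0 < t ->
      is_derive t 1 (fun t => t `^ x * expR (- t) + - (2 * M) * expR (- (t / 2)))
        (g t + x * (t `^ (x - 1) * expR (- t))).
    move=> t0; have d1 := is_derive_powR_expRN x t t0.
    have d2 := is_derive_expRN_half M t.
    by apply: is_derive_eq; rewrite /g /h; ring.
  rewrite (@integral_ge0_FTC2y_pos _ _ e 0 e0 _ _ dF)//.
  - by rewrite /h; congr EFin; ring.
  - move=> t et; apply: addr_ge0; last by rewrite mulr_ge0// ltW.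
    by apply: g0; rewrite /D/= in_itv/= andbT.
  - move=> t t0; apply: cvgD; last by apply: cvgMl_tmp; exact: continuous_powR_expRN.
    by apply: cvgB; [exact: continuous_expRN_half|exact: continuous_powR_expRN].
  - rewrite -(addr0 0); apply: cvgD; first exact: cvg_powR_expRN.
    exact: cvg_expRN_half.
rewrite -/D; rewrite hE in hgE.
move: hgE gE.
set G := (\int[mu]_(t in D) (g t)%:E)%E.
set X := (\int[mu]_(t in D) (t `^ x * expR (- t))%:E)%E.
set Y := (\int[mu]_(t in D) (t `^ (x - 1) * expR (- t))%:E)%E.
have : (0 <= G)%E by apply: integral_ge0 => t /g0; rewrite lee_fin.
have : (0 <= X)%E by apply: integral_ge0 => t _; rewrite lee_fin.
have : (0 <= Y)%E by apply: integral_ge0 => t _; rewrite lee_fin.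
(* All three integrals are nonnegative and enter sums with finite values, so none is infinite;
   eliminating G between the two equations leaves the recursion. *)
case: G => [G| |]//; case: X => [X| |]//.
case: Y => [Y| |]//; rewrite -?EFinM -?EFinD ?lee_fin; last by rewrite gt0_muley ?lte_fin.
move=> Y0 X0 G0 [E1] [E2]; split.
  have h2 : 2 * h e <= 2 * M.
    rewrite /h ler_pM2l// ler_piMr//; first exact: ltW.
    by rewrite -expR0 ler_expR oppr_le0 divr_ge0// ltW.
  by lra.
by congr EFin; lra.
Qed.

Let I (p : R) := (\int[mu]_(t in `]0%R, +oo[) (t `^ p * expR (- t))%:E)%E.

(** Monotone convergence along the increasing half-lines [1/(n+1), oo), whose union is ]0, oo[. *)
Lemma cvg_integral_powR_expRN (p : R) :
  (\int[mu]_(t in `[(n.+1%:R^-1 : R)%R, +oo[) (t `^ p * expR (- t))%:E)%E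
    @[n --> \oo] --> I p.
Proof.
have -> : I p = (\int[mu]_(t in \bigcup_n `[(n.+1%:R^-1 : R)%R, +oo[%classic)
    (t `^ p * expR (- t))%:E)%E.
  rewrite /I itvoyEbigcup; congr (integral _ _ _).
  by apply: eq_bigcupr => n _; rewrite add0r.
apply: ge0_nondecreasing_set_cvg_integral.
- move=> m n mn; rewrite subsetEset; apply: subset_itvr.
  by rewrite bnd_simp lef_pV2 ?posrE ?ltr0n// ler_nat ltnS.
- by move=> i; exact: measurable_itv.
- by move=> i; apply/measurable_EFinP; exact: measurable_powR_expRN.
- by move=> i t _; rewrite lee_fin mulr_ge0 ?powR_ge0 ?expR_ge0.
Qed.

Lemma integral_powR_expRN_ge0 (p : R) : (0 <= I p)%E.
Proof.
by apply: integral_ge0 => t _; rewrite lee_fin mulr_ge0 ?powR_ge0 ?expR_ge0.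
Qed.

(** Let e = 1/(n+1) tend to 0 in [integral_powR_expRN_step]: the bound M does not depend on e, and
    the boundary term is at most e^x, which vanishes in the limit because x > 0. *)
Lemma integral_powR_expRNS (x : R) : 0 < x ->
  I x \is a fin_num /\ I x = (x%:E * I (x - 1))%E.
Proof.
move=> x0; have [M hM] := integral_powR_expRN_step x x0.
have n0 n : 0 < n.+1%:R^-1 :> R by rewrite invr_gt0.
split.
  rewrite ge0_fin_numE ?integral_powR_expRN_ge0//.
  apply: (@le_lt_trans _ _ M%:E); last by rewrite ltry.
  apply: (cvge_to_le (cvg_integral_powR_expRN x)).
  by near=> n; have [] := hM _ (n0 n).
apply: (cvg_unique _ (cvg_integral_powR_expRN x)) => //.
rewrite /=; under eq_cvg do rewrite (hM _ (n0 _)).2.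
rewrite -[(x%:E * I (x - 1))%E]adde0; apply: cvgeD.
- by rewrite fin_num_adde_defl.
- by apply: cvgeZl; [by []|]; exact: cvg_integral_powR_expRN.
- apply: cvg_EFin; first exact: nearW.
  apply: (@squeeze_cvgr _ _ _ _ (fun=> 0) (fun n => (n.+1%:R^-1 : R) `^ x)).
  + by near=> n; rewrite mulr_ge0 ?powR_ge0 ?expR_ge0//= ler_piMr ?powR_ge0//
      -expR0 ler_expR oppr_le0 ltW.
  + exact: cvg_cst.
  + apply: (@cvg_comp _ _ _ (fun n => n.+1%:R^-1 : R) (fun t => t `^ x) _ (0^'+));
      last exact: powR_cvg0.
    move=> A A0; apply: (@filterS _ \oo _ _ _ _ (@cvg_harmonic R _ A0)) => n /=.
    by apply; exact: n0.
Unshelve. all: by end_near. Qed.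

Lemma integral_powR_expRN_gt0 (p : R) : 0 <= p -> (0 < I p)%E.
Proof.
(* On [1, 2] the integrand is at least exp (-2), since t^p >= 1 for p >= 0. *)
move=> p0; apply: (@lt_le_trans _ _ (\int[mu]_(t in `[1%R, 2%R]) (expR (- 2))%:E)%E).
  rewrite integral_cst//= lebesgue_measure_itv/= lte_fin ltr1n -EFinD -EFinM.
  by rewrite lte_fin mulr_gt0 ?expR_gt0// subr_gt0 ltr1n.
apply: (@le_trans _ _ (\int[mu]_(t in `[1%R, 2%R]) (t `^ p * expR (- t))%:E)%E).
  apply: ge0_le_integral => //.
  - by apply/measurable_EFinP; exact: measurable_powR_expRN.
  - move=> t; rewrite /= in_itv/= => /andP[t1 t2]; rewrite lee_fin.
    rewrite -[leLHS]mul1r ler_pM ?expR_ge0 ?ler_expR ?lerN2//.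
    by rewrite -(powRr0 t) ler_powR.
apply: ge0_subset_integral => //=.
- by apply/measurable_EFinP; exact: measurable_powR_expRN.
- by move=> t _; rewrite lee_fin mulr_ge0 ?powR_ge0 ?expR_ge0.
- by move=> t; rewrite /= !in_itv/= andbT => /andP[t1 _]; exact: lt_le_trans t1.
Qed.

Lemma GammaS (x : R) : 0 < x -> Gamma (x + 1) = x * Gamma x.
Proof.
move=> x0; have [Ifin IE] := integral_powR_expRNS x x0.
rewrite /Gamma /Rintegral addrK -/(I x) -/(I (x - 1)) IE fineM//.
move: Ifin; rewrite IE; have := integral_powR_expRN_ge0 (x - 1).
by case: (I (x - 1)) => // _; rewrite gt0_muley ?lte_fin.
Qed.

Lemma Gamma_gt0 (x : R) : 0 < x -> 0 < Gamma x.
Proof.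
(* Multiplying by x raises the exponent from x - 1, possibly negative, to x >= 0, where the lower
   bound on [1, 2] applies. *)
move=> x0; rewrite -(@pmulr_rgt0 _ x)// -GammaS//.
have [Ifin _] := integral_powR_expRNS x x0.
rewrite /Gamma /Rintegral addrK -/(I x) fine_gt0//.
by rewrite integral_powR_expRN_gt0 1?ltW//= ltey_eq Ifin.
Qed.

End GammaFunction.

(** * Size of the Laguerre coefficients *)

Section LaguerreCoefficients.
Context {R : realType}.
Implicit Types (a z : R) (k i : nat).

(** The cutoff is explicit because for i > k the truncated [k - i] is 0 and the quotient would be 1
    / i! instead of 0. *)
Definition laguerre_abs_coef a k i : R :=
  if (i <= k)%N then gbinom (k%:R + a) (k - i) / i`!%:R else 0.

Lemma coef_laguerre a k i :
  (laguerre a k)`_i = (-1) ^+ i * laguerre_abs_coef a k i.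
Proof.
rewrite coef_poly /laguerre_abs_coef ltnS.
by case: leqP => _; rewrite ?mulrA ?mulr0.
Qed.

Lemma gbinomS (x : R) n : gbinom x n.+1 * n.+1%:R = gbinom x n * (x - n%:R).
Proof.
rewrite /gbinom big_ord_recr/= factS natrM invfM.
set P := \prod_(_ < _) _; have h1 : n`!%:R != 0 :> R by rewrite pnatr_eq0 -lt0n fact_gt0.
have : n.+1%:R != 0 :> R by rewrite pnatr_eq0.
move: n.+1%:R n`!%:R n%:R h1 => u v w h1 h2.
by field; rewrite h1.
Qed.

(** The ratio of consecutive coefficients, cleared of denominators so that it includes i = k, where
    both sides vanish. All bounds in i below come from it. *)
Lemma laguerre_abs_coefS a k i : (i <= k)%N ->
  laguerre_abs_coef a k i.+1 * (i.+1%:R * (a + i.+1%:R)) =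
  laguerre_abs_coef a k i * (k%:R - i%:R).
Proof.
rewrite leq_eqVlt => /predU1P[->|ik].
  by rewrite /laguerre_abs_coef ltnn subrr mulr0 mul0r.
rewrite /laguerre_abs_coef ik (ltnW ik).
have -> : (k - i = (k - i.+1).+1)%N by rewrite subnSK.
have := gbinomS (k%:R + a) (k - i.+1).
have -> : k%:R + a - (k - i.+1)%:R = a + i.+1%:R by rewrite natrB//; ring.
rewrite subnSK// natrB ?(ltnW ik)// => E.
rewrite factS natrM invfM.
have h1 : i`!%:R != 0 :> R by rewrite pnatr_eq0 -lt0n fact_gt0.
have h2 : i.+1%:R != 0 :> R by rewrite pnatr_eq0.
apply: (mulfI h1).
transitivity (gbinom (k%:R + a) (k - i.+1) * (a + i.+1%:R)).
  by move: i.+1%:R i`!%:R h1 h2 => u v h1 h2; field; rewrite h1.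
by rewrite -E; move: i`!%:R h1 => v h1; field; rewrite h1.
Qed.

Lemma laguerre_abs_coef0 a k : laguerre_abs_coef a k 0 = gbinom (k%:R + a) k.
Proof. by rewrite /laguerre_abs_coef subn0 fact0 divr1. Qed.

Lemma laguerre_abs_coef00 a : laguerre_abs_coef a 0 0 = 1.
Proof. by rewrite laguerre_abs_coef0 /gbinom big_ord0 fact0 divr1. Qed.

Lemma laguerre_abs_coefS0 a k :
  laguerre_abs_coef a k.+1 0 = laguerre_abs_coef a k 0 * (1 + a / k.+1%:R).
Proof.
rewrite !laguerre_abs_coef0 /gbinom big_ord_recl/= factS natrM invfM.
rewrite (eq_bigr (fun i : 'I_k => k%:R + a - i%:R)) => [|i _]; last first.
  by rewrite /bump/= -!natr1; ring.
set P := \prod_(_ < _) _; have h1 : k`!%:R != 0 :> R by rewrite pnatr_eq0 -lt0n fact_gt0.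
have : k.+1%:R != 0 :> R by rewrite pnatr_eq0.
rewrite -natr1; move: k%:R k`!%:R h1 => u v h1 h2.
by field; rewrite h1 h2.
Qed.

Lemma Gamma_laguerre_abs_coef a k : -1 < a ->
  Gamma (k%:R + a + 1) = Gamma (a + 1) * k`!%:R * laguerre_abs_coef a k 0.
Proof.
move=> a1; elim: k => [|k IH].
  by rewrite add0r fact0 laguerre_abs_coef00 !mulr1.
have -> : k.+1%:R + a + 1 = (k%:R + a + 1) + 1 by rewrite -natr1; ring.
rewrite [LHS]GammaS ?IH; last by have : 0 <= k%:R :> R by []; lra.
rewrite laguerre_abs_coefS0 factS natrM.
have : k.+1%:R != 0 :> R by rewrite pnatr_eq0.
rewrite -natr1; move: k%:R k`!%:R => u v h2.
by field.
Qed.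

(** The case a = 0, where the binomial coefficient is 1. [Gamma 1] stays unevaluated: its positivity
    will suffice. *)
Lemma Gamma_natS k : Gamma (k%:R + 1) = Gamma 1 * k`!%:R :> R.
Proof.
have := @Gamma_laguerre_abs_coef 0 k (ltrN10 _); rewrite addr0 add0r => ->.
suff -> : laguerre_abs_coef 0 k 0 = 1 by rewrite mulr1.
elim: k => [|k IH]; first exact: laguerre_abs_coef00.
by rewrite laguerre_abs_coefS0 IH mul0r addr0 mulr1.
Qed.

Lemma laguerre_abs_coef0_gt0 a k : -1 < a -> 0 < laguerre_abs_coef a k 0.
Proof.
move=> a1; elim: k => [|k IH]; first by rewrite laguerre_abs_coef00.
rewrite laguerre_abs_coefS0 mulr_gt0//.
have k0 : 0 < k.+1%:R :> R by rewrite ltr0n.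
have -> : 1 + a / k.+1%:R = (k.+1%:R + a) / k.+1%:R by rewrite mulrDl divff ?pnatr_eq0.
by rewrite divr_gt0// -natr1; have : 0 <= k%:R :> R by []; lra.
Qed.

(** ln (1 + z) lies between z / (1 + z) and z, and these differ by z^2 / (1 + z), where 1 + z >=
    1/2. *)
Lemma ln1D_sub_le z : - (1 / 2) <= z -> `|ln (1 + z) - z| <= 2 * z ^+ 2.
Proof.
move=> z2; have z1 : 0 < 1 + z by lra.
have h1 : ln (1 + z) <= z by apply: le_ln1Dx; lra.
have h2 : z / (1 + z) <= ln (1 + z).
  have := @le_ln1Dx R (- (z / (1 + z))).
  have -> : 1 + - (z / (1 + z)) = (1 + z)^-1 by field; rewrite gt_eqF.
  rewrite lnV ?posrE// lerN2; apply.
  by rewrite ltrN2 ltr_pdivrMr//; lra.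
have h3 : z - 2 * z ^+ 2 <= z / (1 + z).
  rewrite ler_pdivlMr// -subr_ge0.
  have -> : z - (z - 2 * z ^+ 2) * (1 + z) = z ^+ 2 * (1 + 2 * z) by ring.
  by rewrite mulr_ge0 ?sqr_ge0//; lra.
by rewrite ler_norml; apply/andP; split; nra.
Qed.

(** With y = 1/(k+1), passing from k to k+1 adds ln (1 + a y) - a ln (1 + y), whose linear terms
    cancel, leaving at most (2 a^2 + 2 |a|) y^2. The weight 1 - 1/(k+1) grows by y^2 / (1 + y) >=
    y^2 / 2, which absorbs this and keeps the bound uniform in k. *)
Lemma ln_laguerre_abs_coef0 a k : - (1 / 2) <= a ->
  `|ln (laguerre_abs_coef a k 0) - a * ln (k%:R + 1)| <=
  (4 * a ^+ 2 + 4 * `|a|) * (1 - (k%:R + 1)^-1).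
Proof.
move=> a2; have a1 : -1 < a by lra.
elim: k => [|k IH].
  by rewrite laguerre_abs_coef00 add0r ln1 mulr0 subrr normr0 invr1 subrr mulr0.
pose y : R := k.+1%:R^-1.
have y0 : 0 < y by rewrite invr_gt0.
have y1 : y <= 1 by rewrite invf_le1 ?ler1n ?ltr0n.
have kE : k%:R + 1 = y^-1 :> R by rewrite /y invrK natr1.
have E1 : laguerre_abs_coef a k.+1 0 = laguerre_abs_coef a k 0 * (1 + a * y).
  exact: laguerre_abs_coefS0.
have ay : - (1 / 2) <= a * y by nra.
have E2 : k.+1%:R + 1 = (k%:R + 1) * (1 + y) :> R.
  by rewrite kE -natr1 kE; field; rewrite gt_eqF.
have p1 : 0 < k%:R + 1 :> R by rewrite ltr_wpDl.
have p2 : 0 < 1 + y by lra.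
have p3 : 0 < 1 + a * y by lra.
rewrite E1 E2 (@lnM _ (laguerre_abs_coef a k 0)) ?(@lnM _ (k%:R + 1)) ?posrE
  ?laguerre_abs_coef0_gt0//.
have hA := ln1D_sub_le _ ay.
have hB : `|ln (1 + y) - y| <= 2 * y ^+ 2 by apply: ln1D_sub_le; lra.
have -> : ln (laguerre_abs_coef a k 0) + ln (1 + a * y) -
    a * (ln (k%:R + 1) + ln (1 + y)) =
    (ln (laguerre_abs_coef a k 0) - a * ln (k%:R + 1)) +
    (ln (1 + a * y) - a * y) - a * (ln (1 + y) - y) by ring.
apply: (le_trans (ler_normB _ _)); rewrite normrM.
apply: (le_trans (lerD (ler_normD _ _) (lexx _))).
apply: (@le_trans _ _ ((4 * a ^+ 2 + 4 * `|a|) * (1 - (k%:R + 1)^-1) +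
   2 * (a * y) ^+ 2 + `|a| * (2 * y ^+ 2))).
  by rewrite !lerD// ler_wpM2l.
have : y ^+ 2 / 2 <= (k%:R + 1)^-1 - ((k%:R + 1) * (1 + y))^-1.
  rewrite kE invfM !invrK -subr_ge0.
  have -> : y - y * (1 + y)^-1 - y ^+ 2 / 2 = y ^+ 2 * (1 - y) / (2 * (1 + y)).
    by field; rewrite gt_eqF//; lra.
  by rewrite divr_ge0 ?mulr_ge0 ?sqr_ge0//; lra.
have := normr_ge0 a; have := sqr_ge0 a.
set u := (k%:R + 1)^-1; set v := (_ * (1 + y))^-1; set A := `|a|; rewrite exprMn.
set B := a ^+ 2; set Y := y ^+ 2 => B0 A0 h.
have : 0 <= (4 * B + 4 * A) * (u - v - Y / 2) by rewrite mulr_ge0; lra.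
by lra.
Qed.

Lemma laguerre_abs_coef0_simeq a : - (1 / 2) <= a ->
  exists2 C : R, 0 < C & forall k,
    C^-1 * (k%:R + 1) `^ a <= laguerre_abs_coef a k 0 <= C * (k%:R + 1) `^ a.
Proof.
move=> a2; have a1 : -1 < a by lra.
exists (expR (4 * a ^+ 2 + 4 * `|a|)) => [|k]; first exact: expR_gt0.
set c := 4 * a ^+ 2 + 4 * `|a|.
have c0 : 0 <= c by rewrite /c; have := sqr_ge0 a; have := normr_ge0 a; lra.
have k1 : 0 < k%:R + 1 :> R by rewrite ltr_wpDl.
have L0 := laguerre_abs_coef0_gt0 a k a1.
have h := ln_laguerre_abs_coef0 a k a2; rewrite -/c in h.
have : `|ln (laguerre_abs_coef a k 0) - a * ln (k%:R + 1)| <= c.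
  by rewrite (le_trans h)// ler_piMr// gerBl invr_ge0 ltW.
rewrite ler_norml => /andP[h1 h2].
have -> : laguerre_abs_coef a k 0 = expR (ln (laguerre_abs_coef a k 0)).
  by rewrite lnK// posrE.
rewrite /powR gt_eqF// -expRN -!expRD !ler_expR; apply/andP; split; lra.
Qed.

Lemma laguerre_abs_coef_gt a k i : (k < i)%N -> laguerre_abs_coef a k i = 0.
Proof. by move=> ki; rewrite /laguerre_abs_coef leqNgt ki. Qed.

Lemma laguerre_abs_coef_ge0 a k i : -1 < a -> 0 <= laguerre_abs_coef a k i.
Proof.
move=> a1; elim: i => [|i IH]; first exact/ltW/laguerre_abs_coef0_gt0.
have [ik|ki] := leqP i k; last by rewrite laguerre_abs_coef_gt// ltnS ltnW.
have i0 : 0 <= i%:R :> R by [].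
have p0 : 0 < i.+1%:R * (a + i.+1%:R) :> R.
  by rewrite mulr_gt0 ?ltr0n// -natr1; lra.
rewrite -(pmulr_lge0 _ p0) laguerre_abs_coefS//.
by rewrite mulr_ge0// subr_ge0 ler_nat.
Qed.

(** Each ratio (k - i) / ((i + 1)(a + i + 1)) is at most 2 (k + 1), because a >= -1/2 makes the
    denominator at least 1/2. *)
Lemma laguerre_abs_coef_le a k i : - (1 / 2) <= a ->
  laguerre_abs_coef a k i <=
  laguerre_abs_coef a k 0 * (2 * (k%:R + 1)) ^+ i.
Proof.
move=> a2; have a1 : -1 < a by lra.
have k0 : 0 <= k%:R :> R by [].
elim: i => [|i IH]; first by rewrite expr0 mulr1.
have c0 := laguerre_abs_coef_ge0 a k i a1.
have c1 := laguerre_abs_coef_ge0 a k i.+1 a1.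
have [ik|ki] := leqP i k; last first.
  rewrite laguerre_abs_coef_gt ?ltnS ?(ltnW ki)// mulr_ge0//.
    exact: laguerre_abs_coef_ge0.
have := laguerre_abs_coefS a k i ik.
have i0 : 0 <= i%:R :> R by [].
have : 1 / 2 <= i.+1%:R * (a + i.+1%:R).
  have i1 : 1 <= i.+1%:R :> R by rewrite ler1n.
  by rewrite -[leLHS]mul1r ler_pM//; lra.
rewrite exprSr (mulrA (laguerre_abs_coef a k 0)).
move: (laguerre_abs_coef a k i) (laguerre_abs_coef a k i.+1) (_ * (a + _)) c0 c1 IH.
move=> x y z x0 y0 xh z2 E.
apply: (@le_trans _ _ (x * (2 * (k%:R + 1)))).
  have h : y * (1 / 2) <= y * z by rewrite ler_wpM2l.
  have : x * (k%:R - i%:R) <= x * (k%:R + 1) by rewrite ler_wpM2l//; lra.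
  lra.
by rewrite ler_wpM2r//; lra.
Qed.

(** The numerator k - i of the ratio is at least (k + 1) / (i + 2) as long as i + 1 <= k, so each
    step costs a factor depending on i and a only. *)
Lemma laguerre_abs_coef_ge a i : - (1 / 2) <= a ->
  exists2 m : R, 0 < m & forall k, (i <= k)%N ->
    m * (laguerre_abs_coef a k 0 * (k%:R + 1) ^+ i) <= laguerre_abs_coef a k i.
Proof.
move=> a2; have a1 : -1 < a by lra.
elim: i => [|i [m m0 IH]]; first by exists 1 => // k _; rewrite mul1r expr0 mulr1.
have i0 : 0 <= i%:R :> R by [].
have p0 : 0 < i.+1%:R * (a + i.+1%:R) :> R.
  by rewrite mulr_gt0 ?ltr0n// -natr1; lra.
exists (m / (i.+2%:R * (i.+1%:R * (a + i.+1%:R)))).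
  by rewrite divr_gt0// mulr_gt0 ?ltr0n.
move=> k ik; have := IH k (ltnW ik).
have := laguerre_abs_coefS a k i (ltnW ik).
have h : k%:R + 1 <= (k%:R - i%:R) * i.+2%:R :> R.
  have : i%:R + 1 <= k%:R :> R by rewrite natr1 ler_nat.
  by rewrite -2!natr1; nra.
have q0 : 0 < i.+2%:R :> R by rewrite ltr0n.
have c0 := laguerre_abs_coef_ge0 a k i a1.
rewrite exprSr (mulrA (laguerre_abs_coef a k 0)).
move: (_ * (a + _)) p0 (laguerre_abs_coef a k i) (laguerre_abs_coef a k i.+1) c0.
move=> z z0 x y x0 E hx.
rewrite -(ler_pM2r (mulr_gt0 q0 z0)).
have -> : y * (i.+2%:R * z) = x * (k%:R - i%:R) * i.+2%:R by rewrite -E; ring.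
rewrite mulrAC divfK ?gt_eqF ?mulr_gt0//.
rewrite mulrA -[leRHS]mulrA ler_pM// mulr_ge0 ?(ltW m0)// mulr_ge0//.
exact/ltW/laguerre_abs_coef0_gt0.
Qed.

End LaguerreCoefficients.

(** * Coefficients of the successive derivatives *)

Section DerivativeCoefficients.
Context {R : realType}.
Implicit Types (c : nat -> R) (j l i : nat).

(* [(-1) ^+ i * dcoef l c j i] is the coefficient of [u ^ (l + 2 i - j)] in
   [expR (u ^ 2 / 2)] times the [j]-th derivative of
   [expR (- u ^ 2 / 2) * \sum_i (-1) ^ i c_i u ^ (l + 2 i)]; the truncated
   subtraction makes it vanish as soon as [l + 2 i < j]. *)
Fixpoint dcoef l c j i : R :=
  if j is j'.+1 then
    (l + i.*2 - j')%N%:R * dcoef l c j' i +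
    (if i is i'.+1 then dcoef l c j' i' else 0)
  else c i.

Lemma dcoef_eq0 l c j i : (l + i.*2 < j)%N -> dcoef l c j i = 0.
Proof.
elim: j i => [//|j IH] i lij /=.
have -> : (l + i.*2 - j = 0)%N by apply/eqP; rewrite subn_eq0.
rewrite mul0r add0r; case: i lij => [//|i] lij; apply: IH; lia.
Qed.

Lemma dcoef_gt l c k j i : (forall i, (k < i)%N -> c i = 0) ->
  (k + j < i)%N -> dcoef l c j i = 0.
Proof.
move=> hc; elim: j i => [|j IH] i h /=; first by apply: hc; rewrite addn0 in h.
rewrite IH ?mulr0 ?add0r; last by lia.
by case: i h => [//|i] h; apply: IH; lia.
Qed.

Lemma dcoef_ge0 l c j i : (forall i, 0 <= c i) -> 0 <= dcoef l c j i.
Proof.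
move=> c0; elim: j i => [//|j IH] [|i] /=; rewrite addr_ge0 ?mulr_ge0//.
Qed.

(** Keep only the first summand of the recursion at every step: its integer factor is at least 1 in
    this range. *)
Lemma dcoef_ge_coef l c j i : (forall i, 0 <= c i) -> (j <= l + i.*2)%N ->
  c i <= dcoef l c j i.
Proof.
move=> c0; elim: j => [//|j IH] h /=.
apply: (@le_trans _ _ (dcoef l c j i)); first by apply: IH; lia.
have d0 := dcoef_ge0 l c j i c0.
rewrite -[leLHS]addr0 lerD//; last by case: (i) => // i'; exact: dcoef_ge0.
by rewrite ler_peMl// ler1n; lia.
Qed.

(** Follow one path of the recursion: i shifts along the diagonal from (0, 0), then j - i steps with
    integer factors at least 1. This replaces [dcoef_ge_coef] when [c i] is zero. *)
Lemma dcoef_ge_coef0 l c j i : (forall i, 0 <= c i) ->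
  (i <= j)%N -> (j <= l + i.*2)%N -> c 0 <= dcoef l c j i.
Proof.
move=> c0; elim: j i => [|j IH] i; first by rewrite leqn0 => /eqP ->.
rewrite leq_eqVlt => /predU1P[->|h1] h2 /=.
  rewrite -[leLHS]add0r lerD// ?mulr_ge0//; first exact: dcoef_ge0.
  by apply: IH; lia.
rewrite -[leLHS]addr0 lerD//; last by case: (i) => // i'; exact: dcoef_ge0.
apply: (le_trans (IH i _ _)); [lia|lia|].
by rewrite ler_peMl ?dcoef_ge0// ler1n; lia.
Qed.

(** The integer factor is at most l + 2i <= (l + 2) 2^i. Each derivative thus doubles the geometric
    ratio and multiplies the constant by l + 3, the extra 1 paying for the shifted term. *)
Lemma dcoef_le l c (b N : R) j i : (forall i, 0 <= c i) -> 0 <= b -> 1 <= N ->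
  (forall i, c i <= b * (2 * N) ^+ i) ->
  dcoef l c j i <= b * (l + 3)%:R ^+ j * (2 ^+ j.+1 * N) ^+ i.
Proof.
move=> c0 b0 N1 hc; elim: j i => [|j IH] i /=.
  by rewrite expr0 mulr1 expr1.
set K := b * (l + 3)%:R ^+ j in IH *.
have K0 : 0 <= K by rewrite mulr_ge0// exprn_ge0.
set y := 2 ^+ j.+1 * N in IH *.
have y1 : 1 <= y.
  have : 1 <= (2 : R) ^+ j.+1 by rewrite exprn_ege1// ler1n.
  by rewrite /y; nra.
have -> : b * (l + 3)%:R ^+ j.+1 * (2 ^+ j.+2 * N) ^+ i =
    (l + 2)%:R * 2 ^+ i * (K * y ^+ i) + 2 ^+ i * (K * y ^+ i).
  rewrite /K [in RHS]/y exprS (exprS 2 j.+1) -(mulrA 2) exprMn.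
  have -> : (l + 3)%:R = (l + 2)%:R + 1 :> R by rewrite natr1 addnS.
  by rewrite -/y; ring.
apply: lerD.
  apply: ler_pM => //; first exact: dcoef_ge0.
  rewrite -natrX -natrM ler_nat.
  by have := ltn_expl i (isT : (1 < 2)%N); nia.
have p2 : 1 <= (2 : R) ^+ i by rewrite exprn_ege1// ler1n.
case: i p2 => [|i] p2.
  by rewrite !mulr_ge0 ?exprn_ge0//; lra.
apply: (le_trans (IH i)).
have h0 : 0 <= K * y ^+ i by rewrite mulr_ge0// exprn_ge0//; lra.
rewrite exprS [in leRHS](exprS y).
have -> : 2 * 2 ^+ i * (K * (y * y ^+ i)) = 2 * 2 ^+ i * y * (K * y ^+ i) by ring.
have h1 : 1 <= 2 * 2 ^+ i * y by rewrite -exprS -[leLHS]mulr1 ler_pM.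
by rewrite ler_peMl.
Qed.

(** The polynomial p_j, once n is large enough. Where l + 2i < j the exponent truncates to 0,
    harmlessly, since [dcoef] vanishes there. *)
Definition dpoly l c j n : {poly R} :=
  \sum_(i < n) ((-1) ^+ i * dcoef l c j i) *: 'X^(l + i.*2 - j).

(** The two summands of [dcoef] are the derivative and the product with -X; the latter shifts i by
    one, flips the sign and adds one term to the sum. *)
Lemma dpolyS l c k j : (forall i, (k < i)%N -> c i = 0) ->
  dpoly l c j.+1 (k + j.+1).+1 =
  (dpoly l c j (k + j).+1)^`() - 'X * dpoly l c j (k + j).+1.
Proof.
move=> hc; rewrite /dpoly.
transitivity (\sum_(i < (k + j.+1).+1)
    ((-1) ^+ i * ((l + i.*2 - j)%N%:R * dcoef l c j i)) *: 'X^(l + i.*2 - j.+1) +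
  \sum_(i < (k + j.+1).+1)
    ((-1) ^+ i * (if (i : nat) is i'.+1 then dcoef l c j i' else 0)) *:
       'X^(l + i.*2 - j.+1) : {poly R}).
  by rewrite -big_split/=; apply: eq_bigr => i _; rewrite -scalerDl -mulrDr.
congr (_ + _).
  rewrite addnS big_ord_recr/= (dcoef_gt _ _ _ _ _ hc); last by lia.
  rewrite !mulr0 scale0r addr0.
  rewrite linear_sum/=; apply: eq_bigr => i _.
  rewrite derivZ derivXn -['X^_ *+ _]scaler_nat scalerA mulrA
    -(mulrA _ _%:R) (mulrC _%:R) mulrA.
  by congr (_ *: 'X^_); lia.
rewrite addnS big_ord_recl/= mulr0 scale0r add0r -mulrN -sumrN mulr_sumr.
apply: eq_bigr => i _; rewrite /bump/=.
(* For l + 2i < j the truncated exponents on the two sides need not agree, but the coefficient is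
   zero. *)
have [h|h] := leqP j (l + i.*2); last by rewrite dcoef_eq0// !mulr0 !scale0r oppr0 mulr0.
rewrite mulrN -scalerAr -exprS -scaleNr; congr (_ *: 'X^_); last by lia.
by rewrite exprS mulN1r mulNr.
Qed.

End DerivativeCoefficients.

(** * Derivatives of the Laguerre functions and their normalization *)

Section LaguerreHermite.
Context {R : realType}.
Implicit Types (a : R) (k i j l : nat).

Lemma is_derive_horner_gauss (C : R) (p : {poly R}) (u : R) :
  is_derive u 1 (fun v => C * p.[v] * expR (- (v ^+ 2 / 2)))
    (C * (p^`() - 'X * p).[u] * expR (- (u ^+ 2 / 2))).
Proof.
apply: is_derive_eq.
by rewrite !hornerE /GRing.scale/=; field.
Qed.

Lemma derive1n_horner_gauss (f : R -> R) (C : R) (p : nat -> {poly R}) :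
  (forall j, p j.+1 = (p j)^`() - 'X * p j) ->
  (forall u, 0 < u -> f u = C * (p 0).[u] * expR (- (u ^+ 2 / 2))) ->
  forall j u, 0 < u ->
    derive1n j f u = C * (p j).[u] * expR (- (u ^+ 2 / 2)).
Proof.
move=> hp hf; elim=> [|j IH] u u0; first by rewrite derive1n0 hf.
rewrite derive1nS derive1E.
(* The closed form is known only on the positive half-line, which is a neighbourhood of u. *)
rewrite (@near_eq_derive _ _ _ _
    (fun v => C * (p j).[v] * expR (- (v ^+ 2 / 2)))); last first.
  by near=> v; apply: IH; near: v; exact: lt_nbhsr.
by rewrite hp; have [_ ->] := is_derive_horner_gauss C (p j) u.
Unshelve. all: by end_near. Qed.

Lemma horner_dpoly0 a k l (u : R) :
  (dpoly l (laguerre_abs_coef a k) 0 k.+1).[u] = u ^+ l * (laguerre a k).[u ^+ 2].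
Proof.
rewrite horner_poly /dpoly horner_sum mulr_sumr; apply: eq_bigr => i _.
rewrite hornerZ hornerXn subn0 exprD -muln2 mulnC exprM mulrCA /= -coef_laguerre.
by rewrite coef_poly ltn_ord.
Qed.

Lemma laguerre_hermite_divr a k l (u : R) : 0 < u ->
  laguerre_hermite a k u / u `^ (a + 1 / 2 - l%:R) =
  Num.sqrt (2 * Gamma (k%:R + 1) / Gamma (k%:R + a + 1)) *
  (dpoly l (laguerre_abs_coef a k) 0 k.+1).[u] * expR (- (u ^+ 2 / 2)).
Proof.
move=> u0; rewrite horner_dpoly0 /laguerre_hermite.
have -> : u `^ (a + 1 / 2) = u `^ (a + 1 / 2 - l%:R) * u ^+ l.
  by rewrite -powR_mulrn ?ltW// -powRD ?subrK// (gt_eqF u0) implybT.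
have h := powR_gt0 (a + 1 / 2 - l%:R) u0.
by field; rewrite gt_eqF.
Qed.

Lemma derive1n_laguerre_hermite a k l j (u : R) : 0 < u ->
  derive1n j (fun v => laguerre_hermite a k v / v `^ (a + 1 / 2 - l%:R)) u =
  Num.sqrt (2 * Gamma (k%:R + 1) / Gamma (k%:R + a + 1)) *
  (dpoly l (laguerre_abs_coef a k) j (k + j).+1).[u] * expR (- (u ^+ 2 / 2)).
Proof.
apply: (derive1n_horner_gauss _ _
  (fun j => dpoly l (laguerre_abs_coef a k) j (k + j).+1)).
  by move=> i; apply: dpolyS => n kn; exact: laguerre_abs_coef_gt.
by move=> v v0; rewrite addn0; exact: laguerre_hermite_divr.
Qed.

(** The factorials cancel, and moving b_k = binom(k+a, k) under the root leaves sqrt (d b_k) with d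
    = 2 Gamma(1) / Gamma(a+1); the root halves the exponent a. *)
Lemma sqrt_Gamma_simeq a : - (1 / 2) <= a ->
  exists m M : R, [/\ 0 < m, 0 < M & forall k,
    m * (k%:R + 1) `^ (a / 2) <=
    Num.sqrt (2 * Gamma (k%:R + 1) / Gamma (k%:R + a + 1)) *
      laguerre_abs_coef a k 0 <= M * (k%:R + 1) `^ (a / 2)].
Proof.
move=> a2; have a1 : -1 < a by lra.
have [C C0 hC] := laguerre_abs_coef0_simeq a a2.
have G1 : 0 < Gamma (1 : R) by exact: Gamma_gt0.
have Ga : 0 < Gamma (a + 1) by apply: Gamma_gt0; lra.
pose d := 2 * Gamma 1 / Gamma (a + 1).
have d0 : 0 < d by rewrite divr_gt0// mulr_gt0.
exists (Num.sqrt (d / C)), (Num.sqrt (d * C)); split.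
- by rewrite sqrtr_gt0 divr_gt0.
- by rewrite sqrtr_gt0 mulr_gt0.
move=> k; have L0 := laguerre_abs_coef0_gt0 a k a1.
have kf : 0 < k`!%:R :> R by rewrite ltr0n fact_gt0.
rewrite Gamma_laguerre_abs_coef// Gamma_natS.
have -> : Num.sqrt (2 * (Gamma 1 * k`!%:R) /
    (Gamma (a + 1) * k`!%:R * laguerre_abs_coef a k 0)) *
    laguerre_abs_coef a k 0 = Num.sqrt (d * laguerre_abs_coef a k 0).
  rewrite -[X in _ * X]ger0_norm ?ltW// -sqrtr_sqr -sqrtrM; last first.
    by apply: ltW; apply: divr_gt0; do ![apply: mulr_gt0 => //].
  congr Num.sqrt; rewrite /d.
  have h1 := lt0r_neq0 kf.
  move: (laguerre_abs_coef a k 0) k`!%:R (Gamma (a + 1)) L0 h1 Ga.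
  by move=> x y z x0 y0 z0; field; rewrite y0 !gt_eqF.
have k1 : 0 <= k%:R + 1 :> R by rewrite addr_ge0.
have -> : (k%:R + 1) `^ (a / 2) = Num.sqrt ((k%:R + 1) `^ a).
  by rewrite powRrM powR12_sqrt// powR_ge0.
have p0 : 0 <= (k%:R + 1) `^ a by exact: powR_ge0.
have /andP[h1 h2] := hC k.
rewrite -!sqrtrM ?(ltW (divr_gt0 d0 C0)) ?(ltW (mulr_gt0 d0 C0))//.
by apply/andP; split; apply: ler_wsqrtr; rewrite -(mulrA d) ler_pM2l.
Qed.

(** * Domination by the lowest power of u *)

Lemma geometric_tail_le (x : R) n : 0 <= x <= 1 / 2 ->
  \sum_(i < n) x ^+ i.+1 <= 2 * x.
Proof.
move=> /andP[x0 x2]; elim: n => [|n IH]; first by rewrite big_ord0 mulr_ge0.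
rewrite big_ord_recl/= expr1.
rewrite (eq_bigr (fun i : 'I_n => x * x ^+ i.+1)) => [|i _]; last by rewrite -exprS.
by rewrite -mulr_sumr; nra.
Qed.

Lemma alternating_sum_lead (t : nat -> R) (A x : R) n :
  0 <= x <= 1 / 2 -> (forall i, 0 <= t i <= A * x ^+ i) ->
  `|\sum_(i < n.+1) (-1) ^+ i * t i - t 0| <= 2 * A * x.
Proof.
move=> x02 ht; rewrite big_ord_recl/= mul1r addrC addKr.
apply: (le_trans (ler_norm_sum _ _ _)).
apply: (@le_trans _ _ (\sum_(i < n) A * x ^+ i.+1)).
  apply: ler_sum => i _; rewrite normrM normrX normrN1 expr1n mul1r.
  by have /andP[h1 h2] := ht i.+1; rewrite /bump/= ger0_norm.
have A0 : 0 <= A by have := ht 0; rewrite expr0 mulr1 => /andP[]; exact: le_trans.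
have -> : 2 * A * x = A * (2 * x) by ring.
by rewrite -mulr_sumr ler_wpM2l// geometric_tail_le.
Qed.

(** Here i0 is the first index whose exponent is not negative: earlier terms vanish, and the sign
    and lowest power factor out. *)
Lemma horner_dpoly_lead l (c : nat -> R) j i0 n (u : R) :
  (j <= l + i0.*2)%N -> (forall i, (i < i0)%N -> (l + i.*2 < j)%N) ->
  (i0 <= n)%N ->
  (-1) ^+ i0 * (dpoly l c j n).[u] = u ^+ (l + i0.*2 - j) *
    \sum_(i < n - i0) (-1) ^+ i * (dcoef l c j (i + i0) * (u ^+ 2) ^+ i).
Proof.
move=> h1 h2 h3; rewrite /dpoly horner_sum.
rewrite -(big_mkord xpredT
  (fun i => (((-1) ^+ i * dcoef l c j i) *: 'X^(l + i.*2 - j)).[u])).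
rewrite (@big_cat_nat _ _ _ i0)//= big_nat big1 ?add0r; last first.
  by move=> i /= ii0; rewrite dcoef_eq0 ?h2// mulr0 scale0r horner0.
rewrite (big_addn 0 n i0) big_mkord !mulr_sumr; apply: eq_bigr => i _.
rewrite hornerZ hornerXn.
have -> : (l + (i + i0).*2 - j = (l + i0.*2 - j) + 2 * i)%N by lia.
rewrite exprD exprD exprM.
have := sqrr_sign R i0; rewrite expr2.
move: ((-1) ^+ i0) => s s1.
rewrite -[RHS]mul1r -s1; ring.
Qed.

(** For k >= i the i-th Laguerre coefficient is large enough by itself. For k < i it vanishes, but
    then (k + 1)^i <= (i + 1)^i, so the constant coefficient suffices. *)
Lemma dcoef_laguerre_ge a l j i : - (1 / 2) <= a ->
  (i <= j)%N -> (j <= l + i.*2)%N ->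
  exists2 m : R, 0 < m & forall k,
    m * (laguerre_abs_coef a k 0 * (k%:R + 1) ^+ i) <=
      dcoef l (laguerre_abs_coef a k) j i.
Proof.
move=> a2 ij jl; have a1 : -1 < a by lra.
have [m m0 hm] := laguerre_abs_coef_ge a i a2.
pose m' : R := ((i%:R + 1) ^+ i)^-1.
have i1 : 0 < i%:R + 1 :> R by rewrite ltr_wpDl.
have m'0 : 0 < m' by rewrite invr_gt0 exprn_gt0.
exists (Num.min m m') => [|k]; first by rewrite lt_min m0.
have L0 := laguerre_abs_coef0_gt0 a k a1.
have Lge0 i' := laguerre_abs_coef_ge0 a k i' a1.
have k1 : 0 <= k%:R + 1 :> R by rewrite addr_ge0.
have P0 : 0 <= laguerre_abs_coef a k 0 * (k%:R + 1) ^+ i.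
  by rewrite mulr_ge0 ?exprn_ge0// ltW.
have [ik|ki] := leqP i k.
  apply: (le_trans _ (dcoef_ge_coef l _ j i Lge0 jl)).
  apply: (le_trans _ (hm k ik)).
  by rewrite ler_wpM2r// ge_min lexx.
apply: (le_trans _ (dcoef_ge_coef0 l _ j i Lge0 ij jl)).
apply: (@le_trans _ _ (m' * (laguerre_abs_coef a k 0 * (k%:R + 1) ^+ i))).
  by rewrite ler_wpM2r// ge_min lexx orbT.
rewrite mulrCA ler_piMr ?(ltW L0)// /m' mulrC ler_pdivrMr ?exprn_gt0// mul1r.
by rewrite lerXn2r ?nnegrE ?(ltW i1)// lerD2r ler_nat ltnW.
Qed.

Lemma dpoly_laguerre_simeq a l j i0 : - (1 / 2) <= a ->
  (i0 <= j)%N -> (j <= l + i0.*2)%N ->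
  (forall i, (i < i0)%N -> (l + i.*2 < j)%N) ->
  exists c m M : R, [/\ 0 < c <= 1, 0 < m, 0 < M &
    forall k (u : R), 0 <= u -> u ^+ 2 * (k%:R + 1) <= c ->
    let B := laguerre_abs_coef a k 0 * (k%:R + 1) ^+ i0 * u ^+ (l + i0.*2 - j) in
    m * B <= (-1) ^+ i0 * (dpoly l (laguerre_abs_coef a k) j (k + j).+1).[u]
      <= M * B].
Proof.
move=> a2 i0j jl hi0; have a1 : -1 < a by lra.
have [m m0 hm] := dcoef_laguerre_ge a l j i0 a2 i0j jl.
pose rho : R := 2 ^+ j.+1.
have rho1 : 1 <= rho by rewrite exprn_ege1// ler1n.
pose K : R := (l + 3)%:R ^+ j * rho ^+ i0.
have K0 : 0 < K.
  by rewrite mulr_gt0 ?exprn_gt0 ?ltr0n ?addn3//; lra.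
(* Two demands on c: rho c <= 1/2 for the geometric tail, and c q <= 1, that is 2 K rho c <= m / 2,
   so that the tail is at most half the lower bound of the leading term. *)
pose q := 4 * K * rho / m.
have rho0 : 0 < rho by lra.
have q0 : 0 < q.
  by apply: divr_gt0 => //; apply: mulr_gt0 rho0; exact: mulr_gt0 K0.
have [c [c0 c1 c2 c3]] : exists c, [/\ 0 < c, c <= 1, rho * c <= 1 / 2 & c * q <= 1].
  have d0 : 0 < 2 * rho + q + 1 by lra.
  exists (2 * rho + q + 1)^-1.
  have c0 : 0 < (2 * rho + q + 1)^-1 by rewrite invr_gt0.
  have : (2 * rho + q + 1)^-1 * (2 * rho + q + 1) = 1 by rewrite mulVf ?gt_eqF.
  move: (2 * rho + q + 1)^-1 c0 => c c0 cd.
  have cq := mulr_gt0 c0 q0; have cr := mulr_gt0 c0 rho0.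
  by split; lra.
have {}c3 : 2 * K * (rho * c) <= m / 2.
  move: c3; rewrite /q (mulrA c) ler_pdivrMr// mul1r; lra.
exists c, (m / 2), (K + m / 2); split; [by rewrite c0|by rewrite divr_gt0| |].
  by rewrite addr_gt0// divr_gt0.
move=> k u u0 uc /=.
set b := laguerre_abs_coef a k 0.
set N : R := k%:R + 1.
have N1 : 1 <= N by rewrite /N lerDr.
have b0 : 0 < b by exact: laguerre_abs_coef0_gt0.
have Lge0 i := laguerre_abs_coef_ge0 a k i a1.
have hle : (i0 <= k + j)%N := leq_trans i0j (leq_addl k j).
rewrite (horner_dpoly_lead l (laguerre_abs_coef a k) j i0 (k + j).+1 u
  jl hi0 (leqW hle)) subSn//.
set e := (l + i0.*2 - j)%N.
pose t i := dcoef l (laguerre_abs_coef a k) j (i + i0) * (u ^+ 2) ^+ i.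
pose x := rho * (N * u ^+ 2).
have x0 : 0 <= x by rewrite !mulr_ge0 ?sqr_ge0//; lra.
have xc : x <= rho * c by rewrite /x ler_wpM2l ?(ltW rho0)// mulrC.
pose A := b * K * N ^+ i0.
have bN0 : 0 < b * N ^+ i0 by rewrite mulr_gt0 ?exprn_gt0//; lra.
have ht i : 0 <= t i <= A * x ^+ i.
  have u2 : 0 <= (u ^+ 2) ^+ i by rewrite exprn_ge0 ?sqr_ge0.
  rewrite /t mulr_ge0 ?dcoef_ge0//=.
  have := dcoef_le l _ b N j (i + i0) Lge0 (ltW b0) N1
     (fun i => laguerre_abs_coef_le a k i a2).
  move=> /(ler_wpM2r u2) /le_trans; apply.
  rewrite le_eqVlt; apply/orP; left; apply/eqP.
  rewrite /A /K /x -/rho !exprMn !exprD; ring.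
have x02 : 0 <= x <= 1 / 2 by rewrite x0 (le_trans xc).
have := alternating_sum_lead t A x (k + j - i0) x02 ht.
rewrite -/(t _); set S := \sum_(i < _) _.
have hA : 2 * A * x <= m / 2 * (b * N ^+ i0).
  have -> : 2 * A * x = 2 * K * x * (b * N ^+ i0) by rewrite /A; ring.
  rewrite ler_wpM2r ?(ltW bN0)//; apply: le_trans c3.
  by rewrite ler_wpM2l// mulr_ge0// ltW.
have t0l : m * (b * N ^+ i0) <= t 0 by rewrite /t expr0 mulr1 add0n hm.
have t0u : t 0 <= K * (b * N ^+ i0).
  by have /andP[_] := ht 0; rewrite expr0 mulr1 /A (mulrC b) -mulrA.
rewrite ler_norml => /andP[s1 s2].
have ue : 0 <= u ^+ e by exact: exprn_ge0.
rewrite -!(mulrC (u ^+ e)) !(mulrCA _ (u ^+ e)).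
by apply/andP; split; rewrite ler_wpM2l//; lra.
Qed.

End LaguerreHermite.

(** * The uniform estimate, for both orders of j and l *)

Lemma derive1n_laguerre_hermite_simeq (R : realType) (a : R) (j l : nat) :
  - (1 / 2) <= a ->
  exists c m M : R, [/\ 0 < c, 0 < m, 0 < M &
    forall (k : nat) (u : R), 0 < u -> u < c * (k%:R + 1) `^ (- (1 / 2)) ->
    let B := (k%:R + 1) `^ (a / 2 + (uphalf (j - l))%:R) *
             u ^+ (l + (uphalf (j - l)).*2 - j) in
    m * B <= (-1) ^+ uphalf (j - l) *
      derive1n j
        (fun v : R => laguerre_hermite a k v / v `^ (a + 1 / 2 - l%:R)) u
      <= M * B].
Proof.
(* [uphalf (j - l)] is the least i with j <= l + 2i. Truncated subtraction makes it 0 when j <= l,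
   so both cases are treated at once. *)
have h1 : (uphalf (j - l) <= j)%N by rewrite uphalfE; lia.
have h2 : (j <= l + (uphalf (j - l)).*2)%N by rewrite uphalfE; lia.
have h3 i : (i < uphalf (j - l))%N -> (l + i.*2 < j)%N by rewrite uphalfE; lia.
move: (uphalf (j - l)) h1 h2 h3 => i0 h1 h2 h3 a2; have a1 : -1 < a by lra.
have [c [m1 [M1 [/andP[c0 c1] m10 M10 hS]]]] :=
  dpoly_laguerre_simeq a l j i0 a2 h1 h2 h3.
have [m2 [M2 [m20 M20 hG]]] := sqrt_Gamma_simeq a a2.
exists c, (expR (-1) * m1 * m2), (M1 * M2); split => //.
- by apply: mulr_gt0 => //; apply: mulr_gt0 => //; exact: expR_gt0.
- by apply: mulr_gt0.
move=> k u u0 uc; cbv zeta.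
set B := _ `^ (a / 2 + _) * _ ^+ _.
set N : R := k%:R + 1 in uc B *.
have N1 : 1 <= N by rewrite /N lerDr.
have N0 : 0 < N by rewrite (lt_le_trans _ N1).
(* The hypothesis gives u^2 N <= c^2, and c <= 1. Since also N >= 1, u^2 <= 1 follows, which places
   the Gaussian factor between exp (-1) and 1. *)
have uN : u ^+ 2 * N <= c.
  have p0 : 0 < N `^ (- (1 / 2)) by exact: powR_gt0.
  have pE : N `^ (- (1 / 2)) ^+ 2 * N = 1.
    rewrite -powR_mulrn ?powR_ge0// -powRrM.
    have -> : - (1 / 2) * 2%:R = -1 :> R by field.
    by rewrite powR_inv1 ?(ltW N0)// mulVf ?gt_eqF.
  have : u ^+ 2 <= (c * N `^ (- (1 / 2))) ^+ 2.
    by rewrite lerXn2r ?nnegrE ?(ltW u0) ?(ltW uc)// mulr_ge0 ?(ltW c0) ?(ltW p0).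
  move=> /(ler_wpM2r (ltW N0)) /le_trans; apply.
  by rewrite exprMn -mulrA pE mulr1 expr2 ler_piMl// ltW.
have E1 : expR (- (u ^+ 2 / 2)) <= 1.
  by rewrite -expR0 ler_expR oppr_le0 divr_ge0// sqr_ge0.
have E2 : expR (-1) <= expR (- (u ^+ 2 / 2)).
  have u2 : u ^+ 2 <= 1.
    rewrite (le_trans _ c1)// (le_trans _ uN)//.
    by rewrite ler_peMr// sqr_ge0.
  by rewrite ler_expR lerN2; clear -u2; lra.
have := hS k u (ltW u0) uN; rewrite -/N /= => /andP[s1 s2].
have /andP[g1 g2] := hG k; rewrite -/N in g1 g2.
rewrite derive1n_laguerre_hermite//.
set C := Num.sqrt _ in g1 g2 *.
have C0 : 0 <= C by exact: sqrtr_ge0.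
set S := _.[u] in s1 s2 *; set E := expR (- (u ^+ 2 / 2)) in E1 E2 *.
have -> : (-1) ^+ i0 * (C * S * E) = E * (C * ((-1) ^+ i0 * S)) by ring.
set T := (-1) ^+ i0 * S in s1 s2 *.
have BE : B = N `^ (a / 2) * (N ^+ i0 * u ^+ (l + i0.*2 - j)).
  rewrite /B powRD; last by rewrite (gt_eqF N0) implybT.
  by rewrite powR_mulrn ?(ltW N0)// mulrA.
have X0 : 0 <= N ^+ i0 * u ^+ (l + i0.*2 - j).
  by apply: mulr_ge0; apply: exprn_ge0; exact: ltW.
move: X0 BE s1 s2; rewrite -!(mulrA (laguerre_abs_coef a k 0)).
set X := _ * u ^+ _; set b := laguerre_abs_coef a k 0 in g1 g2 *.
move=> X0 BE s1 s2.
(* The factor [b] in the bounds on [T] is paired with [C], and the product C b is comparable to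
   N^(a/2). *)
have t1 : m1 * (m2 * B) <= C * T.
  apply: (@le_trans _ _ (C * (m1 * (b * X)))); last by rewrite ler_wpM2l.
  rewrite (mulrCA C) ler_pM2l// BE (mulrA m2) (mulrA C).
  by rewrite ler_wpM2r.
have t2 : C * T <= M1 * (M2 * B).
  apply: (@le_trans _ _ (C * (M1 * (b * X)))); first by rewrite ler_wpM2l.
  rewrite (mulrCA C) ler_pM2l// BE (mulrA M2) (mulrA C).
  by rewrite ler_wpM2r.
have B0 : 0 <= m1 * (m2 * B).
  apply: mulr_ge0; first exact: ltW.
  apply: mulr_ge0; first exact: ltW.
  by rewrite BE mulr_ge0// powR_ge0.
have E0 : 0 <= expR (-1) :> R by exact: expR_ge0.
apply/andP; split.
  rewrite -(mulrA (expR (-1) * m1)) -(mulrA (expR (-1))).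
  exact: ler_pM.
rewrite -(mulrA M1) -[leRHS]mul1r; apply: ler_pM => //.
  exact: le_trans E2.
exact: le_trans t1.
Qed.

(* [uphalf n] is the ceiling of n / 2. *)
Theorem lemma4p3 (R : realType) (a : R) (j l : nat) (ha : - (1 / 2) <= a) :
  exists c : R, 0 < c /\
    let D := fun (k : nat) (u : R) =>
      0 < u /\ u < c * (k%:R + 1) `^ (- (1 / 2)) in
    let A := fun (k : nat) (u : R) =>
      derive1n j
        (fun v : R => laguerre_hermite a k v / v `^ (a + 1 / 2 - l%:R)) u in
    ((j <= l)%N ->
       unif_simeq D A (fun k u => (k%:R + 1) `^ (a / 2) * u ^+ (l - j))) /\
    ((l <= j)%N ->
       unif_simeq_sign (uphalf (j - l)) D A
         (fun k u => (k%:R + 1) `^ (a / 2 + (uphalf (j - l))%:R)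
                     * u `^ ((1 - (-1) ^+ (j - l)) / 2))).
Proof.
have [c [m [M [c0 m0 M0 h]]]] := derive1n_laguerre_hermite_simeq R a j l ha.
exists c; split=> // D A.
have simeqI (A' B : nat -> R -> R) :
    (forall k u, D k u -> 0 <= B k u /\ m * B k u <= A' k u <= M * B k u) ->
    unif_simeq D A' B.
  (* The upper constant m + M guarantees the ordering required by [unif_simeq]. *)
  move=> hB; exists m, (m + M); split=> //; first by rewrite lerDl ltW.
  move=> k u Dku; have [B0 /andP[b1 b2]] := hB k u Dku; split=> //.
  by rewrite (le_trans b2)// ler_wpM2r ?lerDr ?(ltW m0).
split=> [jl|lj].
  apply: simeqI => k u [u0 uc]; split.
    by rewrite mulr_ge0 ?powR_ge0// exprn_ge0// ltW.
  have := h k u u0 uc.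
  have /eqP -> : (j - l == 0)%N by rewrite subn_eq0.
  by rewrite /= addr0 addn0 expr0 mul1r.
have BE k u : D k u ->
    (k%:R + 1) `^ (a / 2 + (uphalf (j - l))%:R) *
      u `^ ((1 - (-1) ^+ (j - l)) / 2) =
    (k%:R + 1) `^ (a / 2 + (uphalf (j - l))%:R) *
      u ^+ (l + (uphalf (j - l)).*2 - j).
  move=> [u0 _]; congr (_ * _).
  (* Rounding (j - l) / 2 up leaves the parity of j - l as exponent, which equals (1 - (-1)^(j-l)) /
     2. *)
  have -> : (l + (uphalf (j - l)).*2 - j = odd (j - l))%N.
    by rewrite uphalfE; lia.
  rewrite -signr_odd; case: odd => /=.
    by rewrite expr1 opprK divff// powRr1// ltW.
  by rewrite !expr0 subrr mul0r powRr0.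
rewrite /unif_simeq_sign -signr_odd in h *.
case: ifP h => _ h.
  (* Strict negativity follows from the lower bound, as m and the comparison function are positive
     for u > 0. *)
  split=> [k u Dku|].
    have := h k u Dku.1 Dku.2; rewrite /= expr1 mulN1r => /andP[h1 _].
    rewrite -oppr_gt0 (lt_le_trans _ h1)// mulr_gt0// mulr_gt0 ?powR_gt0 ?ltr_wpDl//.
    by rewrite exprn_gt0//; exact: Dku.1.
  apply: simeqI => k u Dku; split; first by rewrite mulr_ge0 ?powR_ge0.
  by have := h k u Dku.1 Dku.2; rewrite /= expr1 mulN1r BE.
apply: simeqI => k u Dku; split; first by rewrite mulr_ge0 ?powR_ge0.
by have := h k u Dku.1 Dku.2; rewrite /= expr0 mul1r BE.
Qed.
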